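(* Let $A\in\mathbb{R}^{d\times n}$ have columns $a_1,\dots,a_n$, let $f:\mathbb{R}^d\to\mathbb{R}$ be a closed convex function, and let $L_1=\{x\in\mathbb{R}^n:\|x\|_1\le1\}$ be the unit $\ell_1$-ball. Consider $\min_{x\in L_1}f(Ax)$ and let $(x^\star,w^\star)$ be an optimal primal-dual pair. Then for every $i\in\{1,\dots,n\}$, $$|a_i^\top w^\star|+(Ax^\star)^\top w^\star<0\ \Longrightarrow\ x_i^\star=0 .$$
   Context: The constrained problem $\min_{x\in\mathcal{C}}f(Ax)$ is viewed as $\min_x f(Ax)+g(x)$ with $g=\iota_{\mathcal{C}}$ the indicator function of $\mathcal{C}$ ($0$ on $\mathcal{C}$, $+\infty$ outside); its dual is $\min_{w\in\mathbb{R}^d} f^*(w)+g^*(-A^\top w)$, where $h^*(v)=\sup_u v^\top u-h(u)$. An optimal primal-dual pair $(x^\star,w^\star)$ is a pair satisfying the first-order optimality conditions $w^\star\in\partial f(Ax^\star)$, $Ax^\star\in\partial f^*(w^\star)$, $-A^\top w^\star\in\partial g(x^\star)$, $x^\star\in\partial g^*(-A^\top w^\star)$. *)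

(* Defs.v *)
From HB Require Import structures.
From mathcomp Require Import all_boot all_order all_algebra.
From mathcomp Require Import all_classical all_reals all_analysis.

Set Implicit Arguments.
Unset Strict Implicit.
Unset Printing Implicit Defensive.

Import Order.TTheory GRing.Theory Num.Theory.
Import numFieldNormedType.Exports.

Local Open Scope classical_set_scope.
Local Open Scope ring_scope.

Definition dotv (R : realType) (m : nat) (u v : 'cV[R]_m) : R :=
  (u^T *m v) ord0 ord0.

Definition epigraph (R : realType) (m : nat) (f : 'cV[R]_m -> R) :
    set ('cV[R]_m * R) :=
  [set p | f p.1 <= p.2].

Definition closed_function (R : realType) (m : nat) (f : 'cV[R]_m -> R) : Prop :=
  closed (epigraph f).

Definition conjugate (R : realType) (m : nat) (h : 'cV[R]_m -> \bar R)
    (v : 'cV[R]_m) : \bar R :=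
  ereal_sup [set ((dotv v u)%:E - h u)%E | u in [set: 'cV[R]_m]].

(* The finiteness clause makes the subdifferential empty outside the effective
   domain; without it the constant function [+oo] would have every vector as
   a subgradient. *)
Definition subdifferential (R : realType) (m : nat) (h : 'cV[R]_m -> \bar R)
    (x : 'cV[R]_m) : set 'cV[R]_m :=
  [set v | h x \is a fin_num /\
           forall u, (h x + (dotv v (u - x))%:E <= h u)%E].

Definition indicator (R : realType) (m : nat) (C : set 'cV[R]_m)
    (x : 'cV[R]_m) : \bar R :=
  if x \in C then 0%E else +oo%E.

Definition l1_ball (R : realType) (m : nat) : set 'cV[R]_m :=
  [set x | \sum_i `|x i ord0| <= 1].

Definition optimal_primal_dual_pair (R : realType) (d n : nat)
    (A : 'M[R]_(d, n)) (f : 'cV[R]_d -> \bar R) (g : 'cV[R]_n -> \bar R)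
    (x : 'cV[R]_n) (w : 'cV[R]_d) : Prop :=
  [/\ subdifferential f (A *m x) w,
      subdifferential (conjugate f) w (A *m x),
      subdifferential g x (- (A^T *m w)) &
      subdifferential (conjugate g) (- (A^T *m w)) x].

(* Main.v *)
(** Write c = A^T w.  The condition -c \in ∂ι(x) says that x minimizes c·u over
    the l1-ball.  If x_i <> 0, moving the mass |x_i| from the coordinate i onto x
    itself gives the point u = x - x_i e_i + |x_i| x, which stays in the ball,
    while c·(u - x) <= |x_i| (|c_i| + c·x) < 0. *)
Require Import Defs.
From HB Require Import structures.
From mathcomp Require Import all_boot all_order all_algebra.
From mathcomp Require Import all_classical all_reals all_analysis.
From mathcomp Require Import lra.
Import Order.TTheory GRing.Theory Num.Theory.
Import numFieldNormedType.Exports.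
Local Open Scope classical_set_scope.
Local Open Scope ring_scope.

Lemma dotvDr (R : realType) (m : nat) (u v v' : 'cV[R]_m) :
  dotv u (v + v') = dotv u v + dotv u v'.
Proof. by rewrite /dotv mulmxDr mxE. Qed.

Lemma dotvZr (R : realType) (m : nat) (a : R) (u v : 'cV[R]_m) :
  dotv u (a *: v) = a * dotv u v.
Proof. by rewrite /dotv -scalemxAr mxE. Qed.

Lemma dotvNl (R : realType) (m : nat) (u v : 'cV[R]_m) :
  dotv (- u) v = - dotv u v.
Proof. by rewrite /dotv linearN /= mulNmx mxE. Qed.

Lemma dotvC (R : realType) (m : nat) (u v : 'cV[R]_m) : dotv u v = dotv v u.
Proof. by rewrite /dotv !mxE; apply: eq_bigr => j _; rewrite !mxE mulrC. Qed.

Lemma dotv_trmul (R : realType) (d n : nat) (A : 'M[R]_(d, n))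
    (w : 'cV[R]_d) (x : 'cV[R]_n) :
  dotv (A^T *m w) x = dotv (A *m x) w.
Proof. by rewrite [RHS]dotvC /dotv trmx_mul trmxK mulmxA. Qed.

(** With t = |x_i|, coordinate i becomes t x_i and every other one is scaled by 1 + t, so the new
    norm is (1 + t) ‖x‖_1 - t <= 1. *)
Lemma l1_ball_spread (R : realType) (n : nat) (x : 'cV[R]_n) (i : 'I_n) :
  @l1_ball R n x ->
  @l1_ball R n (x + (- x i ord0 *: delta_mx i ord0 + `|x i ord0| *: x)).
Proof.
rewrite /l1_ball /= => xL; set t := `|x i ord0|.
have -> : \sum_j `|(x + (- x i ord0 *: delta_mx i ord0 + t *: x)) j ord0|
    = (\sum_j `|x j ord0|) * (1 + t) - t.
  rewrite mulr_suml (bigD1 i) //= [in RHS](bigD1 i) //= addrAC !mxE !eqxx.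
  congr (_ + _).
    rewrite mulr1 addrA subrr add0r normrM normr_id -/t; lra.
  apply: eq_bigr => j /negbTE ji; rewrite !mxE ji /= mulr0 add0r.
  rewrite -[X in X + _]mul1r -mulrDl normrM mulrC.
  by rewrite [`|1 + t|]ger0_norm ?addr_ge0 ?normr_ge0 ?ler01.
by have := ler_wpM2r (addr_ge0 ler01 (normr_ge0 (x i ord0))) xL; rewrite -/t; lra.
Qed.

(** The finiteness clause forces [x] into [C]; on [C] the indicator vanishes, which leaves the
    normal cone inequality. *)
Lemma subdifferential_indicator (R : realType) (m : nat) (C : set 'cV[R]_m)
    (x v : 'cV[R]_m) :
  subdifferential (indicator C) x v ->
  C x /\ forall u, C u -> dotv v (u - x) <= 0.
Proof.
rewrite /subdifferential /indicator /=; case: ifPn => [/set_mem Cx|_] [] //.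
move=> _ vC; split=> // u Cu; have := vC u.
by rewrite mem_set // add0e lee_fin.
Qed.

Theorem theorem10 (R : realType) (d n : nat) (A : 'M[R]_(d, n))
    (f : 'cV[R]_d -> R)
    (f_convex : convex_function [set: 'cV[R]_d] f)
    (f_closed : closed_function f)
    (x : 'cV[R]_n) (w : 'cV[R]_d)
    (xw_opt : optimal_primal_dual_pair A (fun u => (f u)%:E)
                (indicator (@l1_ball R n)) x w)
    (i : 'I_n) :
  `|dotv (col i A) w| + dotv (A *m x) w < 0 -> x i ord0 = 0.
Proof.
move=> screen; case: xw_opt => _ _ /subdifferential_indicator[xL xmin] _.
apply/eqP; apply: contraT => xi0.
have := xmin _ (l1_ball_spread _ _ _ i xL).
(* As A e_i is column a_i, minimality at the spread point reads 0 <= - x_i (a_i·w) + |x_i|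
   ((Ax)·w). *)
rewrite addrC addKr dotvNl dotvDr !dotvZr !dotv_trmul -colE oppr_le0.
set c := dotv (col i A) w in screen *.
(* This bound holds whatever the signs of x_i and [c], so the right-hand side above is at most |x_i|
   (|c| + (Ax)·w), which is negative since x_i <> 0. *)
have : - x i ord0 * c <= `|x i ord0| * `|c|.
  by rewrite -normrM mulNr ler_normr lexx orbT.
have : `|x i ord0| * (`|c| + dotv (A *m x) w) < 0.
  by rewrite pmulr_rlt0 // normr_gt0.
by rewrite mulrDr; lra.
Qed.
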